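(* Let $G$ be a tree of order $n \ge 5$. If $Z(G)=n-3$, then $G$ is the graph obtained from the star $S_{n-1}=K_{1,n-2}$ by subdividing one of its edges once (i.e., replacing one edge $vx$ by a path $v,s,x$ through a new vertex $s$).
   Context: For a finite simple graph $G$, color a set $S\subseteq V(G)$ black and all other vertices white. The color-change rule: if a black vertex $u$ has exactly one white neighbor $w$, then $w$ is turned black. $S$ is a zero forcing set if repeated application of the rule eventually turns all vertices black; $Z(G)$ is the minimum size of a zero forcing set. $S_{n-1}=K_{1,n-2}$ is the star on $n-1$ vertices. *)

(* Defs.v *)
From HB Require Import structures.
From mathcomp Require Import all_boot.

Set Implicit Arguments.
Unset Strict Implicit.
Unset Printing Implicit Defensive.

Record sgraph := SGraph {
  vertex :> finType;
  adj : rel vertex;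
  adj_sym : symmetric adj;
  adj_irr : irreflexive adj }.

Definition connected_graph (G : sgraph) : Prop :=
  0 < #|G| /\ forall x y : G, connect (@adj G) x y.

(* In a simple graph [ucycle] also accepts [:: x; y] for adjacent x, y,
   hence the length condition. *)
Definition acyclic (G : sgraph) : Prop :=
  ~ exists c : seq G, 2 < size c /\ ucycle (@adj G) c.

Definition is_tree (G : sgraph) : Prop := connected_graph G /\ acyclic G.

Definition isomorphic (G H : sgraph) : Prop :=
  exists f : G -> H, bijective f /\ forall x y : G, adj (f x) (f y) = adj x y.

Section ZeroForcing.
Variable G : sgraph.
Implicit Types B S : {set G}.

Definition white_neighbors B (u : G) : {set G} := [set w | adj u w & w \notin B].

Definition forces B (u w : G) : bool :=
  (u \in B) && (white_neighbors B u == [set w]).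

Definition color_change B B' : bool :=
  [exists u, exists w, forces B u w && (B' == w |: B)].

Definition zero_forcing_set S : bool := connect color_change S [set: G].

Definition zero_forcing_number : nat :=
  #|[arg min_(S < [set: G] | zero_forcing_set S) #|S| ]|.

Lemma zero_forcing_setT : zero_forcing_set [set: G].
Proof. exact: connect0. Qed.

Lemma zero_forcing_numberP :
  (exists2 S, zero_forcing_set S & #|S| = zero_forcing_number) /\
  (forall S, zero_forcing_set S -> zero_forcing_number <= #|S|).
Proof.
rewrite /zero_forcing_number; case: arg_minnP; first exact: zero_forcing_setT.
by move=> S zS minS; split=> //; exists S.
Qed.

End ZeroForcing.

Section CompleteBipartite.
Variables m n : nat.

Definition bip_adj (a b : 'I_m + 'I_n) : bool :=
  match a, b with
  | inl _, inr _ | inr _, inl _ => true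
  | _, _ => false
  end.

Lemma bip_adj_sym : symmetric bip_adj. Proof. by case=> ? []. Qed.
Lemma bip_adj_irr : irreflexive bip_adj. Proof. by case. Qed.

Definition complete_bipartite : sgraph := SGraph bip_adj_sym bip_adj_irr.

End CompleteBipartite.

(* Has m vertices for 1 <= m. *)
Definition star (m : nat) : sgraph := complete_bipartite 1 (m - 1).

(* Subdivision of the edge v x of G: [None] is the new vertex. Only meaningful
   when [adj v x] holds. *)
Section Subdivide.
Variables (G : sgraph) (v x : G).

Definition subdiv_adj (a b : option G) : bool :=
  match a, b with
  | Some a, Some b => adj a b && ([set a; b] != [set v; x])
  | None, Some c | Some c, None => c \in [set v; x]
  | None, None => false
  end.

Lemma subdiv_adj_sym : symmetric subdiv_adj.
Proof. by case=> [a|] [b|] //=; rewrite adj_sym setUC. Qed.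
Lemma subdiv_adj_irr : irreflexive subdiv_adj.
Proof. by case=> [a|] //=; rewrite adj_irr. Qed.

Definition subdivide : sgraph := SGraph subdiv_adj_sym subdiv_adj_irr.

End Subdivide.

(* Main.v *)
Require Import Defs.
From HB Require Import structures.
From mathcomp Require Import all_boot.
From mathcomp Require Import zify.

(** In a tree, a path on five vertices is induced, so its first vertex forces
the other four; two adjacent vertices with two further neighbours each likewise
give four forced vertices.  Hence [Z(G) = n - 3] excludes both configurations.
A star is excluded because two white leaves with a common neighbour stay white
forever, so that [Z >= n - 2].  Thus some edge [u v] has both ends of degree at
least two, every vertex is within distance one of it, and one end has degree
exactly two: this is the subdivided star. *)

(** * Forcing sequences, and the lower bound for stars *)

Section Forcing.
Variable G : sgraph.
Implicit Types (a b c u w x y : G) (B : {set G}) (s : seq G).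

Lemma forces_zero_forcing B u w :
  forces B u w -> zero_forcing_set (w |: B) -> zero_forcing_set B.
Proof.
move=> fBuw; apply: connect_trans; apply: connect1.
by apply/existsP; exists u; apply/existsP; exists w; rewrite fBuw eqxx.
Qed.

Lemma zero_forcing_setC_nil : zero_forcing_set [set x : G | x \notin [::]].
Proof.
have -> : [set x : G | x \notin [::]] = [set: G] by apply/setP=> x; rewrite !inE.
exact: zero_forcing_setT.
Qed.

(** White vertices are listed in the order in which they get forced: the head [w] is the only
    neighbour of the black vertex [u] in the list, so one force leaves exactly [s] white. *)
Lemma zero_forcing_setC_cons u w s :
    u \notin w :: s -> w \notin s -> adj u w -> all (fun z => ~~ adj u z) s ->
    zero_forcing_set [set x | x \notin s] ->
  zero_forcing_set [set x | x \notin w :: s].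
Proof.
move=> us ws uw /allP nus zs; apply: (@forces_zero_forcing _ u w); last first.
  rewrite (_ : w |: _ = [set x | x \notin s]) //.
  by apply/setP=> x; rewrite !inE negb_or; case: eqP => // ->; rewrite ws.
rewrite /forces inE us /=; apply/eqP/setP=> x; rewrite !inE negbK.
case: eqP => [->|_] /=; first by rewrite uw.
by apply/negP=> /andP[ux /nus]; rewrite ux.
Qed.

Lemma zero_forcing_number_leC s :
  uniq s -> zero_forcing_set [set x | x \notin s] ->
  zero_forcing_number G <= #|G| - size s.
Proof.
move=> us /(proj2 (zero_forcing_numberP G)) /leq_trans; apply.
have <- : #|[set x in s]| = size s by rewrite cardsE; apply/card_uniqP.
rewrite -(cardsC [set x in s]) addKn.
by apply/eq_leq/eq_card=> x; rewrite !inE.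
Qed.

(** Only [c] can force [a] or [b], and while both are white it has two white neighbours. The
    induction follows the sequence of colour changes. *)
Lemma twin_leaves_zero_forcing c a b B : a != b ->
    (forall u, adj u a = (u == c)) -> (forall u, adj u b = (u == c)) ->
  zero_forcing_set B -> (a \in B) || (b \in B).
Proof.
move=> ab la lb /connectP[p]; elim: p B => [|B' p IH] B /=.
  by move=> _ <-; rewrite inE.
case/andP=> /existsP[u /existsP[w /andP[/andP[uB /eqP wn] /eqP->]]] pth lst.
apply/negPn/negP; rewrite negb_or => /andP[aB bB].
have := IH _ pth lst; rewrite !inE (negPf aB) (negPf bB) !orbF.
(* By induction [w] is [a] or [b], hence [u] is [c]; then both leaves are the unique white neighbour
   [w], against [a != b]. *)
have wa : (a == w) = (u == c).
  by move/setP/(_ a): wn; rewrite !inE la aB andbT.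
have wb : (b == w) = (u == c).
  by move/setP/(_ b): wn; rewrite !inE lb bB andbT.
rewrite wa wb orbb => uc; case/negP: ab.
by move: wa wb; rewrite uc => /eqP-> /eqP->.
Qed.

(** Any two vertices other than [c] are twin leaves, so a zero forcing set misses at most one of
    them, and possibly [c]. *)
Lemma star_zero_forcing_number c :
    (forall x y, adj x y = (x == c) (+) (y == c)) ->
  #|G| <= (zero_forcing_number G).+2.
Proof.
move=> adjE; have [[S zS <-] _] := zero_forcing_numberP G.
have leaf a : a != c -> forall u, adj u a = (u == c).
  by move=> /negPf ac u; rewrite adjE ac addbF.
have le1 : #|~: S :\ c| <= 1.
  apply/card_le1P=> a; rewrite !inE => /andP[ac aS] b; rewrite !inE.
  apply/andP/eqP=> [[bc bS]|-> //]; apply/eqP/negPn/negP=> ba.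
  have:= @twin_leaves_zero_forcing c b a S ba (leaf b bc) (leaf a ac) zS.
  by rewrite (negPf aS) (negPf bS).
rewrite -(cardsC S) (cardsD1 c (~: S)); case: (c \in _); lia.
Qed.

End Forcing.

(** * Forcing chains in acyclic graphs *)

Section Trees.
Variable G : sgraph.
Hypothesis acycG : acyclic G.
Implicit Types (a b c d e t u v x y z : G) (p : seq G).

Lemma acyclic_nadj x p :
  1 < size p -> path (@adj G) x p -> uniq (x :: p) -> adj x (last x p) = false.
Proof.
move=> sp pth up; apply/negP=> xl; case: acycG; exists (x :: p); split=> //.
by rewrite /ucycle up andbT /= rcons_path pth adj_sym.
Qed.

Lemma adj_neq x y : adj x y -> x != y.
Proof. by apply: contraTneq => ->; rewrite adj_irr. Qed.

(** The case [x = z] is covered by irreflexivity, which spares a distinctness condition. *)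
Lemma acyclic_triangle x y z : adj x y -> adj y z -> adj x z = false.
Proof.
move=> xy yz; have [->|xz] := eqVneq x z; first by rewrite adj_irr.
apply: (@acyclic_nadj x [:: y; z]); rewrite //= ?xy ?yz //.
by rewrite !inE negb_or xz (adj_neq _ _ xy) (adj_neq _ _ yz).
Qed.

(** The two inequalities exclude walks that backtrack; [x != t] follows from the absence of
    triangles. *)
Lemma acyclic_square x y z t :
  adj x y -> adj y z -> adj z t -> x != z -> y != t -> adj x t = false.
Proof.
move=> xy yz zt xz yt; apply: (@acyclic_nadj x [:: y; z; t]).
- by [].
- by rewrite /= xy yz zt.
have xt : x != t.
  by apply: contraTneq zt => <-; rewrite adj_sym (acyclic_triangle _ _ _ xy yz).
by rewrite /= !inE !negb_or xz xt yt !adj_neq.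
Qed.

Lemma P5_zero_forcing_number a b c d e :
    uniq [:: a; b; c; d; e] -> path (@adj G) a [:: b; c; d; e] ->
  zero_forcing_number G <= #|G| - 4.
Proof.
move=> uq pth; have nae := acyclic_nadj a [:: b; c; d; e] isT pth uq.
move: pth; rewrite /= andbT => /and4P[ab bc cd de].
move: (uq); rewrite /= !inE !negb_or -!andbA.
case/and5P=> nab nac nad ne /and5P[nbc nbd nbe ncd /andP[nce /andP[nde _]]].
have uq4 : uniq [:: b; c; d; e] by case/andP: uq.
(* [T] and [Q] exclude the shorter chords and [nae] the longest, so each vertex of the path sees
   only the next one among the vertices still white. *)
have T := acyclic_triangle; have Q := acyclic_square.
apply: (zero_forcing_number_leC _ _ uq4).
apply: (zero_forcing_setC_cons _ a) => //=;
  rewrite ?inE ?negb_or ?nab ?nac ?nad ?nbc ?nbd ?nbe //.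
  rewrite (T a b c) // (Q a b c d) //; by rewrite /= in nae; rewrite nae.
apply: (zero_forcing_setC_cons _ b) => //=;
  rewrite ?inE ?negb_or ?nbc ?nbd ?nbe ?ncd ?nce //.
  by rewrite (T b c d) // (Q b c d e).
apply: (zero_forcing_setC_cons _ c) => //=;
  rewrite ?inE ?negb_or ?ncd ?nce //.
  by rewrite (T c d e).
apply: (zero_forcing_setC_cons _ d) => //=; rewrite ?inE //.
exact: zero_forcing_setC_nil.
Qed.

(** With [u], [v], [a'], [b'] white, [a] forces [u], [b] forces [v], then [u] forces [a'] and [v]
    forces [b']. *)
Lemma double_star_zero_forcing_number u v a a' b b' :
    adj u v -> adj u a -> adj u a' -> adj v b -> adj v b' ->
    uniq [:: v; a; a'] -> uniq [:: u; b; b'] ->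
  zero_forcing_number G <= #|G| - 4.
Proof.
move=> uv ua ua' vb vb'; rewrite /= !inE !negb_or !andbT -!andbA.
case/and3P=> va va' aa' /and3P[nub nub' bb'].
have [vu au a'u bv b'v] : [/\ adj v u, adj a u, adj a' u, adj b v & adj b' v].
  by split; rewrite adj_sym.
have T := acyclic_triangle; have Q := acyclic_square.
have nab x y : adj u x -> v != x -> adj v y -> u != y -> (x != y) * (adj x y = false).
  move=> ux vx vy uy; split.
    by apply: contraTneq ux => ->; rewrite (T u v y).
  by apply: (Q x u v y) => //; rewrite 1?adj_sym // eq_sym.
have uq : uniq [:: u; v; a'; b'].
  by rewrite /= !inE !negb_or (nab a' b') // va' nub' !adj_neq.
apply: (zero_forcing_number_leC _ _ uq).
apply: (zero_forcing_setC_cons _ a) => //=.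
- by rewrite !inE !negb_or aa' (nab a b') // (eq_sym a v) va adj_neq.
- by case/andP: uq.
- by rewrite (T a u v) // (T a u a') // (nab a b').
apply: (zero_forcing_setC_cons _ b) => //=.
- by rewrite !inE !negb_or bb' (eq_sym b a') (nab a' b) // adj_neq.
- by case/and3P: uq.
- by rewrite (adj_sym b a') (nab a' b) // (T b v b').
apply: (zero_forcing_setC_cons _ u) => //=.
- by rewrite !inE !negb_or nub' adj_neq.
- by rewrite !inE (nab a' b').
- by rewrite (T u v b').
apply: (zero_forcing_setC_cons _ v) => //=; first by rewrite inE adj_neq.
exact: zero_forcing_setC_nil.
Qed.

End Trees.

(** * Shape of a tree around an edge with two inner ends *)

Section Structure.
Variable G : sgraph.
Hypothesis treeG : is_tree G.
Implicit Types (a b c t u v w x y z : G).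

Lemma connected_closed (P : pred G) x :
  P x -> (forall y z, P y -> adj y z -> P z) -> forall y, P y.
Proof.
move=> Px clP y; have [[_ conn] _] := treeG.
case/connectP: (conn x y) => p; elim: p x Px => [|z p IH] x Px /=.
  by move=> _ ->.
by case/andP=> xz; apply: IH; apply: clP xz.
Qed.

(** If every edge has an end of degree one, all neighbours of a vertex [c] of degree at least two
    are leaves, and by connectedness nothing else exists. *)
Lemma star_or_inner_edge : 2 < #|G| ->
  (exists c, forall x y : G, adj x y = (x == c) (+) (y == c)) \/
  (exists u v a b : G, [/\ adj u v, adj u a, adj v b, a != v & b != u]).
Proof.
move=> n3.
case: (boolP [exists u : G, exists v : G, exists a : G, exists b : G,
   [&& adj u v, adj u a, adj v b, a != v & b != u]]).
  case/existsP=> u /existsP[v /existsP[a /existsP[b /and5P[? ? ? ? ?]]]].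
  by right; exists u, v, a, b.
move=> nE; left.
have inner u v a b : adj u v -> adj u a -> adj v b -> a != v -> b = u.
  move=> uv ua vb av; apply/eqP/negPn/negP=> bu; case/negP: nE.
  apply/existsP; exists u; apply/existsP; exists v; apply/existsP; exists a.
  by apply/existsP; exists b; rewrite uv ua vb av bu.
(* Otherwise a single vertex, or the two ends of an edge, would be closed under adjacency and
   exhaust the graph. *)
have [c [a [b [ca cb ab]]]] : exists c a b : G, [/\ adj c a, adj c b & a != b].
  have [[/card_gt0P[x _] _] _] := treeG.
  case: (boolP [exists y, adj x y]) => [/existsP[y xy]|/existsPn nx]; last first.
    have Px := @connected_closed (pred1 x) x (eqxx x).
    have : #|G| <= #|pred1 x|.
      apply: subset_leq_card; apply/subsetP=> y _; apply: Px => z t /eqP->.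
      by rewrite (negPf (nx t)).
    by rewrite card1; lia.
  case: (boolP [exists z, (z != y) && adj x z])
    => [/existsP[z /andP[zy xz]]|/existsPn nx].
    by exists x, y, z; rewrite eq_sym.
  case: (boolP [exists z, (z != x) && adj y z])
    => [/existsP[z /andP[zx yz]]|/existsPn ny].
    by exists y, x, z; rewrite adj_sym eq_sym.
  have : #|G| <= #|pred2 x y|.
    apply: subset_leq_card; apply/subsetP=> z _.
    apply: (@connected_closed (pred2 x y) x); first by rewrite /= eqxx.
    move=> s t /= /orP[] /eqP-> adjt.
      by have := nx t; rewrite adjt andbT negbK => ->; rewrite orbT.
    by have := ny t; rewrite adjt andbT negbK => ->.
  by rewrite card2; lia.
(* One of [a], [b] differs from [x] and serves as the second neighbour of [c]. *)
have leaf x y : adj c x -> adj x y -> y = c.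
  move=> cx xy; have [ax|ax] := eqVneq a x.
    by apply: (inner c x b y) => //; rewrite -ax eq_sym.
  exact: (inner c x a y).
have dom x : (x == c) || adj c x.
  apply: (@connected_closed (fun x => (x == c) || adj c x) c); first by rewrite eqxx.
  move=> y z /orP[/eqP-> ->|cy yz]; first by rewrite orbT.
  by rewrite (leaf y z cy yz) eqxx.
exists c => x y; have [->|xc] := eqVneq x c.
  have [->|yc] := eqVneq y c; first by rewrite adj_irr.
  by have := dom y; rewrite (negPf yc).
have [->|yc] := eqVneq y c.
  by have := dom x; rewrite (negPf xc) adj_sym.
apply/negP=> xy; have := dom x; rewrite (negPf xc) => /= cx.
by case/eqP: yc; apply: leaf xy.
Qed.

(** A vertex outside this neighbourhood but adjacent to it would start a five-vertex path running
    through the edge to [b] or [a], giving a zero forcing set that is too small. *)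
Lemma inner_edge_dominates u v a b :
    #|G| - 4 < zero_forcing_number G ->
    adj u v -> adj u a -> adj v b -> a != v -> b != u ->
  forall y, adj u y || adj v y.
Proof.
move=> Z uv ua vb av bu; have [_ acyc] := treeG.
have T := @acyclic_triangle G acyc.
have noP5 x y w z t : adj w z -> adj w x -> adj z t -> x != z -> t != w ->
    adj x y -> adj w y || adj z y.
  move=> wz wx zt xz tw xy; case/boolP: (_ || _) => // /norP[nwy nzy].
  have : zero_forcing_number G <= #|G| - 4; last by lia.
  have pth : path (@adj G) y [:: x; w; z; t].
    by rewrite /= wz zt (adj_sym y x) (adj_sym x w) wx xy.
  apply: (@P5_zero_forcing_number G acyc y x w z t _ pth).
  have yw : y != w by apply: contraNneq nzy => ->; rewrite adj_sym.
  have yz : y != z by apply: contraNneq nwy => ->.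
  have yt : y != t by apply: contraNneq nzy => ->.
  have xt : x != t by apply: contraTneq wx => ->; rewrite (T w z t).
  rewrite /= !inE !negb_or yw yz yt xt xz (eq_sym y) (eq_sym w t) tw.
  by rewrite (eq_sym x w) !adj_neq.
apply: (@connected_closed (fun y => adj u y || adj v y) u).
  by rewrite (adj_sym v) uv orbT.
move=> x y /orP[ux|vx] xy.
  have [xv|xv] := eqVneq x v; first by rewrite -xv xy orbT.
  exact: (noP5 x y u v b).
have [xu|xu] := eqVneq x u; first by rewrite -xu xy.
by rewrite orbC; apply: (noP5 x y v u a); rewrite // adj_sym.
Qed.

(** Here [u] is the centre, [v] the subdividing vertex and [b] the end of the subdivided edge.
    Domination joins the other vertices to [u]; acyclicity excludes further edges. *)
Lemma subdivided_star_iso u v b : 1 < #|G| ->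
    adj u v -> b != u -> (forall y, adj v y = (y == u) || (y == b)) ->
    (forall y, adj u y || adj v y) ->
  exists c x : star (#|G| - 1), adj c x /\ isomorphic G (subdivide c x).
Proof.
move=> n2 uv bu vE dom; have [_ acyc] := treeG.
have T := @acyclic_triangle G acyc; have Q := @acyclic_square G acyc.
pose L : {set G} := ~: [set u; v].
have cardL : #|L| = #|G| - 1 - 1.
  by rewrite cardsCs setCK cards2 adj_neq //; lia.
have vb : adj v b by rewrite vE eqxx orbT.
have bL : b \in L by rewrite !inE negb_or bu eq_sym adj_neq.
(* Numbers the star's leaves; outside [L] the value is a meaningless default, whence the membership
   conditions in [r_eq]. *)
pose r (y : G) := cast_ord cardL (enum_rank_in bL y).
have r_eq y z : y \in L -> z \in L -> (r y == r z) = (y == z).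
  move=> yL zL; apply/eqP/eqP=> [/cast_ord_inj|-> //].
  exact: enum_rank_in_inj.
pose f (y : G) : subdivide (inl ord0 : star (#|G| - 1)) (inr (r b)) :=
  if y == v then None else if y == u then Some (inl ord0) else Some (inr (r y)).
exists (inl ord0), (inr (r b)); split=> //; exists f.
have LP y : y != v -> y != u -> y \in L by move=> yv yu; rewrite !inE negb_or yu yv.
split.
  apply: inj_card_bij.
    move=> y z; rewrite /f.
    have [->|yv] := eqVneq y v; have [->|zv] := eqVneq z v => //.
    - by case: (z == u).
    - by case: (y == u).
    have [->|yu] := eqVneq y u; have [->|zu] := eqVneq z u => //.
    by move=> /eqP; rewrite -[_ == _]/(r y == r z) r_eq ?LP // => /eqP.
  by rewrite card_option card_sum !card_ord; lia.
have uE y : y != v -> y != u -> adj u y = (y != b).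
  move=> yv yu; have [->|yb] := eqVneq y b; first by rewrite (T u v b).
  by have := dom y; rewrite vE (negPf yu) (negPf yb) !orbF => ->.
(* Two such vertices other than [b] share the neighbour [u]; an edge from [b] to another one, [t],
   would close the square [b], [v], [u], [t]. *)
have LE y z : y != v -> y != u -> z != v -> z != u -> adj y z = false.
  have bz t : t != v -> t != u -> t != b -> adj b t = false.
    move=> tv tu tb; have ut : adj u t by rewrite uE.
    by apply: (Q b v u t); rewrite // 1?(adj_sym b) 1?(adj_sym v u) // eq_sym.
  move=> yv yu zv zu.
  have [->|yb] := eqVneq y b.
    by have [->|zb] := eqVneq z b; [rewrite adj_irr | apply: bz].
  have [->|zb] := eqVneq z b; first by rewrite adj_sym bz.
  by apply: (T y u z); rewrite ?(adj_sym y) uE.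
(* Identifies the one star edge that subdivision removes. *)
have pairE (y : G) : ([set inl ord0; inr (r y)] == [set inl ord0; inr (r b)]
    :> {set star (#|G| - 1)}) = (r y == r b).
  apply/eqP/eqP=> [/setP/(_ (inr (r y)))|-> //].
  by rewrite !inE eqxx orbT => /esym; apply: (@eqP _ (r y) (r b)).
move=> y z; rewrite /f.
have [->|yv] := eqVneq y v; have [->|zv] := eqVneq z v.
- by rewrite !adj_irr.
- rewrite vE; have [->|zu] := eqVneq z u; rewrite /= !inE ?eqxx //=.
  exact: (r_eq z b (LP _ zv zu) bL).
- rewrite (adj_sym y) vE; have [->|yu] := eqVneq y u; rewrite /= !inE ?eqxx //=.
  exact: (r_eq y b (LP _ yv yu) bL).
have [->|yu] := eqVneq y u; have [->|zu] := eqVneq z u.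
- by rewrite !adj_irr.
- by rewrite uE //= pairE (r_eq z b (LP _ zv zu) bL).
- by rewrite (adj_sym y) uE //= setUC pairE (r_eq y b (LP _ yv yu) bL).
- by rewrite LE.
Qed.

End Structure.

Theorem theorem4p5 (G : sgraph) (n : nat)
    (hG : is_tree G) (hcard : #|G| = n) (hn : 5 <= n)
    (hZ : zero_forcing_number G = n - 3) :
  exists v x : star (n - 1), adj v x /\ isomorphic G (subdivide v x).
Proof.
subst n; have [_ acyc] := hG.
(* Subtraction is truncated, so the strict inequality relies on the lower bound on the order. *)
have Z4 : #|G| - 4 < zero_forcing_number G by lia.
have [|[c cE]|[u [v [a [b [uv ua vb av bu]]]]]] := star_or_inner_edge G hG;
  first lia.
  by have := star_zero_forcing_number G c cE; lia.
have dom := inner_edge_dominates G hG u v a b Z4 uv ua vb av bu.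
have vu : adj v u by rewrite adj_sym.
(* An end of degree two is the subdividing vertex; if neither end is one, the extra neighbours [a']
   and [b'] complete a double star. *)
case: (boolP [forall y, adj v y ==> (y == u) || (y == b)]) => [/forallP vE|].
  apply: (@subdivided_star_iso G hG u v b) => //; first lia.
  move=> y; apply/idP/idP=> [vy|/orP[]/eqP-> //].
  by have := vE y; rewrite vy.
rewrite negb_forall => /existsP[b']; rewrite negb_imply negb_or => /and3P[vb' b'u b'b].
case: (boolP [forall y, adj u y ==> (y == v) || (y == a)]) => [/forallP uE|].
  apply: (@subdivided_star_iso G hG v u a) => //; first lia.
    move=> y; apply/idP/idP=> [uy|/orP[]/eqP-> //].
    by have := uE y; rewrite uy.
  by move=> y; rewrite orbC.
rewrite negb_forall => /existsP[a']; rewrite negb_imply negb_or => /and3P[ua' a'v a'a].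
have : zero_forcing_number G <= #|G| - 4; last by lia.
apply: (@double_star_zero_forcing_number G acyc u v a a' b b') => //.
  by rewrite /= !inE !negb_or !(eq_sym v) (eq_sym a a') av a'v a'a.
by rewrite /= !inE !negb_or !(eq_sym u) (eq_sym b b') bu b'u b'b.
Qed.
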